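(* Let $\mathbb{K}$ be a field of characteristic zero and $\mathbb{F}\subset\mathbb{K}$ a subfield. Let $q\colon\mathbb{F}\to\mathbb{K}$ be a quadratic function. If the mapping $x\mapsto q(x)/x^2$ is additive on the multiplicative group $\mathbb{F}^{\times}$, that is, \[ q(xy)=q(x)y^{2}+x^{2}q(y) \] holds for all $x,y\in\mathbb{F}^{\times}$, then there exists a second order derivation $d\colon\mathbb{F}\to\mathbb{K}$ such that \[ q(x)=4x\,d(x)-d(x^{2})\qquad (x\in\mathbb{F}). \]
   Context: $\mathbb{F}^{\times}=\mathbb{F}\setminus\{0\}$. A function $q\colon\mathbb{F}\to\mathbb{K}$ is called quadratic if there is a symmetric bi-additive map $B\colon\mathbb{F}\times\mathbb{F}\to\mathbb{K}$ with $q(x)=B(x,x)$ for all $x\in\mathbb{F}$. Derivations of higher order: the identically zero map is the only derivation $\mathbb{F}\to\mathbb{K}$ of order $0$. For $n\geq 1$, an additive map $f\colon\mathbb{F}\to\mathbb{K}$ is a derivation of order $n$ if there exists $B\colon\mathbb{F}\times\mathbb{F}\to\mathbb{K}$ which is a derivation of order $n-1$ in each variable such that $f(xy)-xf(y)-f(x)y=B(x,y)$ for all $x,y\in\mathbb{F}$. Thus derivations of order 1 are exactly the additive maps with $f(xy)=xf(y)+f(x)y$, and a second order derivation is an additive map $f$ for which $(x,y)\mapsto f(xy)-xf(y)-f(x)y$ is a derivation of order 1 in each variable. In particular every derivation of order 1 is a derivation of order 2. *)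

(* Defs.v *)
From HB Require Import structures.
From mathcomp Require Import all_boot all_order all_algebra.

Set Implicit Arguments.
Unset Strict Implicit.
Unset Printing Implicit Defensive.

Import GRing.Theory.
Local Open Scope ring_scope.

(* The subfield F of K is a [subFieldType]: its elements are regarded as
   elements of K through the inclusion [val : F -> K]. *)

Definition additive_map (U V : zmodType) (f : U -> V) : Prop :=
  {morph f : x y / x + y}.

Definition biadditive_map (U V W : zmodType) (B : U -> V -> W) : Prop :=
  (forall y, additive_map (fun x => B x y)) /\
  (forall x, additive_map (fun y => B x y)).

Definition quadratic_map (U V : zmodType) (q : U -> V) : Prop :=
  exists B : U -> U -> V,
    [/\ biadditive_map B, (forall x y, B x y = B y x)
      & forall x, q x = B x x].

Fixpoint derivation_of_order (n : nat) (K : fieldType) (S : pred K)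
    (F : subFieldType S) (f : F -> K) : Prop :=
  match n with
  | 0 => forall x : F, f x = 0
  | n'.+1 =>
      additive_map f /\
      exists B : F -> F -> K,
        [/\ (forall y, derivation_of_order n' (fun x => B x y)),
            (forall x, derivation_of_order n' (fun y => B x y))
          & forall x y : F,
              f (x * y) - val x * f y - f x * val y = B x y]
  end.

(* Main.v *)
(* The map [d x = B(x, 1)] works, where [B] is the symmetric bi-additive map of
   [q].  Polarizing the functional equation in both variables gives
     [B(xy, zt) + B(xt, zy) = 2 B(x, z) y t + 2 x z B(y, t)].
   At [z = t = 1] this is [B(x, y) = 2 x d(y) + 2 y d(x) - d(x y)], whose diagonal
   is the required formula.  Substituting this back and setting only [t = 1] gives
     [d(xyz) = x d(yz) + y d(xz) + z d(xy) - xy d(z) - xz d(y) - yz d(x)],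
   which characterizes the second order derivations among the additive maps. *)
Require Import Defs.
From HB Require Import structures.
From mathcomp Require Import all_boot all_order all_algebra.
From mathcomp Require Import ring.

Set Implicit Arguments.
Unset Strict Implicit.
Unset Printing Implicit Defensive.

Import GRing.Theory.
Local Open Scope ring_scope.

Section SecondOrder.
Variables (K : fieldType) (S : pred K) (F : subFieldType S).
Implicit Types (d : F -> K) (x y z t : F).

Lemma derivation_of_order1 d :
  additive_map d ->
  (forall x y, d (x * y) = val x * d y + d x * val y) ->
  derivation_of_order 1 d.
Proof.
move=> dD dM; split=> //; exists (fun _ _ => 0); split=> // x y.
by rewrite dM; ring.
Qed.

(** The hypothesis, rearranged, is exactly the Leibniz rule in each variable for the defect
    [d (x * y) - val x * d y - d x * val y]. *)
Lemma derivation_of_order2 d :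
  additive_map d ->
  (forall x y z, d (x * y * z) =
     val x * d (y * z) + val y * d (x * z) + val z * d (x * y)
     - val x * val y * d z - val x * val z * d y - val y * val z * d x) ->
  derivation_of_order 2 d.
Proof.
move=> dD dM; split=> //.
exists (fun x y => d (x * y) - val x * d y - d x * val y); split=> // [y|x].
  apply: derivation_of_order1 => [x z|x z].
    by rewrite mulrDl !dD rmorphD /=; ring.
  by rewrite dM rmorphM /=; ring.
apply: derivation_of_order1 => [y z|y z].
  by rewrite mulrDr !dD rmorphD /=; ring.
by rewrite mulrA dM rmorphM /=; ring.
Qed.

Section Polarization.
Hypothesis two_neq0 : (2 : K) != 0.
Variables (q : F -> K) (B : F -> F -> K).
Hypothesis B_biadd : biadditive_map B.
Hypothesis B_sym : forall x y, B x y = B y x.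
Hypothesis qE : forall x, q x = B x x.
Hypothesis qM : forall x y, q (x * y) = q x * val y ^+ 2 + val x ^+ 2 * q y.

Lemma quadratic_mapD x y : q (x + y) = q x + q y + 2 * B x y.
Proof.
by rewrite !qE (proj1 B_biadd) !(proj2 B_biadd) (B_sym y x); ring.
Qed.

(** Polarization of [qM] in its first factor: put [x + z] for [x] and compare cross terms, which
    carry a factor 2. *)
Lemma polar_mull x z y :
  B (x * y) (z * y) = B x z * val y ^+ 2 + val x * val z * q y.
Proof.
apply: (mulfI two_neq0); have := qM (x + z) y.
rewrite mulrDl !quadratic_mapD !qM rmorphD /= => h.
by apply: (addrI (q x * val y ^+ 2 + val x ^+ 2 * q y
                  + (q z * val y ^+ 2 + val z ^+ 2 * q y))); rewrite h; ring.
Qed.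

Lemma polar_mul x z y t :
  B (x * y) (z * t) + B (x * t) (z * y) =
  2 * B x z * val y * val t + 2 * val x * val z * B y t.
Proof.
have := polar_mull x z (y + t).
rewrite !mulrDr (proj1 B_biadd) !(proj2 B_biadd) !polar_mull quadratic_mapD.
rewrite rmorphD /= => h.
(* The added terms are [B (x * y) (z * y)] and [B (x * t) (z * t)], so only the mixed terms in [y]
   and [t] survive. *)
apply: (addrI (B x z * val y ^+ 2 + val x * val z * q y
               + (B x z * val t ^+ 2 + val x * val z * q t))).
by transitivity (B x z * (val y + val t) ^+ 2
      + val x * val z * (q y + q t + 2 * B y t)); [rewrite -h|]; ring.
Qed.

Lemma polar_one x y :
  B x y = 2 * val x * B y 1 + 2 * val y * B x 1 - B (x * y) 1.
Proof.
have := polar_mul x 1 y 1; rewrite !mulr1 mul1r rmorph1 => h.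
by apply: (addrI (B (x * y) 1)); rewrite h; ring.
Qed.

Lemma polar_one_mul x y z :
  B (x * y * z) 1 =
  val x * B (y * z) 1 + val y * B (x * z) 1 + val z * B (x * y) 1
  - val x * val y * B z 1 - val x * val z * B y 1 - val y * val z * B x 1.
Proof.
apply: (mulfI two_neq0); have := polar_mul x y z 1.
rewrite !mulr1 (polar_one (x * z) y) (polar_one x (y * z)) (polar_one x y).
rewrite !rmorphM rmorph1 /= (mulrA x y z) (mulrAC x z y) => h.
set D := B (x * y * z) 1 in h *.
(* The bracket subtracted here is the left side of [h]; it contains [- D] twice, so the whole equals
   [2 * D], and rewriting with [h] eliminates [D]. *)
transitivity (2 * val x * B (y * z) 1 + 2 * (val y * val z) * B x 1
   + (2 * (val x * val z) * B y 1 + 2 * val y * B (x * z) 1)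
   - (2 * (val x * val z) * B y 1 + 2 * val y * B (x * z) 1 - D
     + (2 * val x * B (y * z) 1 + 2 * (val y * val z) * B x 1 - D))).
  by ring.
by rewrite h; ring.
Qed.

End Polarization.
End SecondOrder.

Theorem theorem7 (K : fieldType) (charK0 : [pchar K] =i pred0)
    (S : pred K) (F : subFieldType S) (q : F -> K)
    (q_quadratic : quadratic_map q)
    (q_mul : forall x y : F, x != 0 -> y != 0 ->
       q (x * y) = q x * val y ^+ 2 + val x ^+ 2 * q y) :
  exists d : F -> K,
    derivation_of_order 2 d /\
    forall x : F, q x = 4 * val x * d x - d (x ^+ 2).
Proof.
have two_neq0 : (2 : K) != 0 by rewrite (proj1 (pcharf0P K) charK0).
have [B [B_biadd B_sym qE]] := q_quadratic.
have q0 : q 0 = 0.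
  by apply: (addrI (q 0)); rewrite qE -(proj1 B_biadd) !addr0.
(* Polarization substitutes sums that may vanish, so the equation is first extended to zero
   arguments. *)
have qM x y : q (x * y) = q x * val y ^+ 2 + val x ^+ 2 * q y.
  have [->|x0] := eqVneq x 0; first by rewrite mul0r q0 rmorph0; ring.
  have [->|y0] := eqVneq y 0; first by rewrite mulr0 q0 rmorph0; ring.
  exact: q_mul.
exists (fun x => B x 1); split=> [|x].
  apply: derivation_of_order2 => [x y|x y z]; first exact: (proj1 B_biadd).
  exact: polar_one_mul B_biadd B_sym qE qM x y z.
by rewrite qE (polar_one two_neq0 B_biadd B_sym qE qM) expr2; ring.
Qed.
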